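(* Let $\Omega$ be a set, and $s,t\in\mathcal{J}(\Omega)$, the monoid of all injective functions from $\Omega$ to $\Omega$. If $\Omega$ is infinite, then $s\sim_s t$ if and only if $|\Omega\setminus s(\Omega)|=|\Omega\setminus t(\Omega)|$. If $\Omega$ is finite, and hence $\mathcal{J}(\Omega)=\mathcal{S}(\Omega)$ is the group of all permutations of $\Omega$, then $s\sim_s t$ if and only if $st^{-1}$ is an even permutation.
   Context: For a monoid $S$ and $s,t\in S$, $s\sim_s^1 t$ means there exist a positive integer $n$, elements $p_1,\dots,p_n\in S$, and a permutation $f$ of $\{1,\dots,n\}$ with $s=p_1\cdots p_n$ and $t=p_{f(1)}\cdots p_{f(n)}$; $\sim_s$ is the transitive closure of $\sim_s^1$. Here the monoid is $S=\mathcal{J}(\Omega)$ under composition, and $|\cdot|$ denotes cardinality. *)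

(* Defs.v *)
From HB Require Import structures.
From Stdlib Require Import Relation_Operators.
From mathcomp Require Import all_boot fingroup perm.
From mathcomp Require Import boolp classical_sets functions cardinality.

Set Implicit Arguments.
Unset Strict Implicit.
Unset Printing Implicit Defensive.

Local Open Scope group_scope.

Definition sim1 (S : monoidType) (s t : S) : Prop :=
  exists (n : nat) (p : 'I_n -> S) (f : 'S_n),
    [/\ (0 < n)%N, s = \prod_(i < n) p i & t = \prod_(i < n) p (f i)].

Definition sim (S : monoidType) : S -> S -> Prop := clos_trans S (@sim1 S).

Record injmap (T : Type) := InjMap {
  injmap_fun :> T -> T;
  injmapP : injective injmap_fun
}.

Section InjectionMonoid.
Variable T : Type.
Implicit Types s t u : injmap T.

Lemma injmap_eq s t : injmap_fun s = injmap_fun t -> s = t.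
Proof.
by case: s t => [f fi] [g gi] /= efg; subst g; congr InjMap; exact: Prop_irrelevance.
Qed.

HB.instance Definition _ := gen_eqMixin (injmap T).
HB.instance Definition _ := gen_choiceMixin (injmap T).

(* Maps are written on the left: s * t is "t, then s". *)
Definition injmap_mul s t : injmap T := InjMap (inj_comp (@injmapP T s) (@injmapP T t)).

Definition injmap_one : injmap T := InjMap (@inj_id T).

Fact injmap_mulA : associative injmap_mul.
Proof. by move=> s t u; exact: injmap_eq. Qed.

Fact injmap_mul1 : left_id injmap_one injmap_mul.
Proof. by move=> s; exact: injmap_eq. Qed.

Fact injmap_mulr1 : right_id injmap_one injmap_mul.
Proof. by move=> s; exact: injmap_eq. Qed.

HB.instance Definition _ :=
  isMonoid.Build (injmap T) injmap_mulA injmap_mul1 injmap_mulr1.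

End InjectionMonoid.

(* A type whose full set is finite carries, by choice, a finType structure on
   the same carrier, so that {perm _} and odd_perm apply to it.  The parity of a
   permutation does not depend on the chosen structure. *)
Definition fin_carrier (T : Type) of finite_set [set: T] : Type := T.

Section FiniteCarrier.
Variables (T : Type) (finT : finite_set [set: T]).

Fact fin_enum_ex : exists e : seq {classic T}, forall x, x \in e.
Proof.
have [e eT] := (@finite_seqP {classic T} setT).1 finT.
by exists e => x; have : [set: {classic T}]%classic x by []; rewrite eT.
Qed.

Definition fin_enum : seq {classic T} := sval (cid fin_enum_ex).

Fact fin_code_lt (x : {classic T}) : (index x fin_enum < size fin_enum)%N.
Proof. by rewrite index_mem; exact: (svalP (cid fin_enum_ex)). Qed.

Definition fin_code (x : fin_carrier finT) : 'I_(size fin_enum) :=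
  Ordinal (fin_code_lt x).

Definition fin_decode (i : 'I_(size fin_enum)) : option (fin_carrier finT) :=
  onth fin_enum i.

Fact fin_codeK : pcancel fin_code fin_decode.
Proof.
move=> x; rewrite /fin_decode /= (@onthE {classic T}).
rewrite (@nth_map {classic T} x) ?fin_code_lt //.
by rewrite (@nth_index {classic T}) // -index_mem fin_code_lt.
Qed.

HB.instance Definition _ := Finite.copy (fin_carrier finT) (pcan_type fin_codeK).

Definition injmap_perm (s : injmap T) : {perm fin_carrier finT} :=
  perm (@injmapP T s : @injective (fin_carrier finT) (fin_carrier finT) s).

(* The product of {perm _} applies its left factor first, so this is the
   composite s \o t^-1 of maps written on the left. *)
Definition injmap_div (s t : injmap T) : {perm fin_carrier finT} :=
  (injmap_perm t)^-1 * injmap_perm s.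

End FiniteCarrier.

(* Main.v *)
Require Import Defs.
From mathcomp Require Import all_boot fingroup perm.
From mathcomp Require Import boolp classical_sets functions cardinality.
From Stdlib Require Import Relation_Operators.

(** The relation [sim] is the least congruence that makes the monoid
    commutative ([sim_sym], [simM], [simC], [sim_least]), so any map to a
    commutative monoid is constant on its classes, while in any product of
    invertible elements a commutator may be deleted.

    Infinite case.  The complement of the range of [s * t] is the disjoint
    union of the complement of the range of [s] and the image under [s] of the
    complement of the range of [t]; hence its cardinality is additive, and it
    is an invariant of [sim] ([sim_card_setC_range]).  Conversely, if the two
    complements are equinumerous, gluing a bijection between them to the map
    [s x |-> t x] yields a bijection [g] with [t = g * s]
    ([card_setC_range_bijection]), and it remains to see that every bijection
    of an infinite set is [sim]-equivalent to [1] ([sim_bijection]).  Reflecting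
    each orbit of [g] about a base point writes [g] as a product of two
    involutions ([bijection_two_involutions]).  An involution [i] moving
    infinitely many points has infinitely many 2-cycles; pairing these up by an
    involution [t] that commutes with [i], and letting [h] be [i] on one 2-cycle
    of each pair, gives [i = h * t * h * t], a commutator
    ([sim_involution_infinite]).  An involution moving finitely many points is a
    product of two involutions moving infinitely many ([sim_involution]).
    The pairing needs a fixed-point-free involution of an arbitrary infinite
    set, which comes from a maximal partial matching
    ([infinite_fpf_involution]); no cardinal arithmetic is used.

    Finite case.  The sign is a morphism to a commutative group, hence an
    invariant.  Conversely an even permutation is a product of an even number of
    transpositions, and since transpositions are conjugate the product of any
    two of them is [sim]-equivalent to the square of one, that is to [1]
    ([sim_tpermM]). *)

Set Implicit Arguments.
Unset Strict Implicit.
Unset Printing Implicit Defensive.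

Local Open Scope classical_set_scope.
Local Open Scope card_scope.
Local Open Scope group_scope.

(** * The least commutative congruence *)

Section SimCongruence.
Variable S : monoidType.
Implicit Types (s t u v : S) (l : seq S).

(** Finite sequences can be concatenated and cut without reindexing, which
    makes them easier to handle than families indexed by ordinals. *)
Lemma sim1_perm_eq s t :
  sim1 s t <-> exists l l', [/\ perm_eq l l', s = \prod_(x <- l) x
                                & t = \prod_(x <- l') x].
Proof.
have prod_tuple n (F : 'I_n -> S) :
  \prod_(x <- [tuple F i | i < n]) x = \prod_(i < n) F i.
  by rewrite big_tuple; apply: eq_bigr => i _; rewrite tnth_mktuple.
split=> [[n [p [f [_ -> ->]]]]|[l [l' [ll' -> ->]]]].
  exists [tuple p i | i < n], [tuple p (f i) | i < n].
  rewrite !prod_tuple; split=> //; rewrite perm_sym.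
  apply/tuple_permP; exists f; congr (tval _).
  by apply: eq_mktuple => i; rewrite tnth_mktuple.
(* Prepending 1 makes both words nonempty without changing the products. *)
have /(@tuple_permP S _ _ (in_tuple (1 :: l)))[f El'] :
  perm_eq (1 :: l') (1 :: l) by rewrite perm_cons perm_sym.
exists (size l).+1, (tnth (in_tuple (1 :: l))), f; split=> //.
  transitivity (\prod_(x <- in_tuple (1 :: l)) x); last by rewrite big_tuple.
  by rewrite big_cons mul1g.
transitivity (\prod_(x <- 1 :: l') x); first by rewrite big_cons mul1g.
by rewrite El' prod_tuple.
Qed.

Lemma sim_refl s : sim s s.
Proof. by apply: t_step; apply/sim1_perm_eq; exists [:: s], [:: s];
  rewrite big_seq1. Qed.

Lemma sim_trans t s u : sim s t -> sim t u -> sim s u.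
Proof. exact: t_trans. Qed.

Lemma sim_sym s t : sim s t -> sim t s.
Proof.
elim=> [x y /sim1_perm_eq[l [l' [ll' -> ->]]]|x y z _ yx _ zy].
  by apply: t_step; apply/sim1_perm_eq; exists l', l; rewrite perm_sym.
exact: sim_trans zy yx.
Qed.

Lemma sim_mul u v s t : sim s t -> sim (u * s * v) (u * t * v).
Proof.
elim=> [x y /sim1_perm_eq[l [l' [ll' -> ->]]]|x y z _ xy _ yz]; last first.
  exact: sim_trans xy yz.
apply: t_step; apply/sim1_perm_eq; exists (u :: l ++ [:: v]), (u :: l' ++ [:: v]).
by rewrite perm_cons perm_cat2r !big_cons !big_cat !big_seq1 !mulgA.
Qed.

Lemma simM s s' t t' : sim s s' -> sim t t' -> sim (s * t) (s' * t').
Proof.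
move=> /(sim_mul 1 t) ss' /(sim_mul s' 1) tt'.
by move: ss' tt'; rewrite !mul1g !mulg1; exact: sim_trans.
Qed.

Lemma simC s t : sim (s * t) (t * s).
Proof.
apply: t_step; apply/sim1_perm_eq; exists [:: s; t], [:: t; s].
by rewrite !big_cons !big_nil !mulg1 (perm_catC [:: s] [:: t]).
Qed.

(** This is how invariants of [sim] are obtained: moving one letter of a word to
    the front is a single use of commutativity, so a permuted word is reached
    by induction on its length. *)
Lemma sim_least (R : S -> S -> Prop) :
    (forall s, R s s) -> (forall s t, R s t -> R t s) ->
    (forall s t u, R s t -> R t u -> R s u) ->
    (forall s s' t t', R s s' -> R t t' -> R (s * t) (s' * t')) ->
    (forall s t, R (s * t) (t * s)) ->
  forall s t, sim s t -> R s t.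
Proof.
move=> Rxx Rsym Rtr RM RC s t; elim=> [x y|x y z _ xy _ yz]; last first.
  exact: Rtr xy yz.
case/sim1_perm_eq=> l [l' [ll' -> ->]].
elim: l l' ll' => [|a l IHl] l' ll'.
  by have /nilP-> : nilp l' by rewrite /nilp -(perm_size ll').
have al' : a \in l' by rewrite -(perm_mem ll') mem_head.
case/splitPr: al' ll' => l1 l2 ll'.
have {}ll' : perm_eq l (l1 ++ l2).
  by rewrite -(perm_cons a) (perm_trans ll') // -cat1s perm_catCA.
have := RM _ _ _ _ (Rxx a) (IHl _ ll').
rewrite !big_cat !big_cons /= => Rl; apply: Rtr Rl _.
by rewrite !mulgA; apply: (RM (a * _) (_ * a)).
Qed.

End SimCongruence.

(** * Infinite sets have fixed-point-free involutions *)

Lemma set_selector (T : Type) (x0 : T) :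
  exists c : set T -> T, forall (A : set T) x, A x -> A (c A).
Proof.
by exists (fun A => @xget {classic T} x0 A) => A x Ax; apply: (@xgetPex {classic T}); exists x.
Qed.

(** Hilbert's hotel: shift along an infinite sequence starting at [p], and fix
    everything else. *)
Lemma infinite_bij_setC1 (T : Type) (p : T) : infinite_set [set: T] ->
  exists2 f : T -> T, injective f & forall y, y <> p <-> exists x, f x = y.
Proof.
move=> infT.
have [u [uS uI]] : exists u : nat -> T, (forall n, u n <> p) /\ injective u.
  have /infiniteP := infinite_setD infT (finite_set1 p).
  elim/Ppointed: T => T in p infT *; first by have := no p.
  move=> /pcard_leP[u]; exists u; split=> [n|m n umn].
    by have [] : ([set: T] `\ p) (u n) by apply: funS.
  by apply: (@inj _ _ _ u); rewrite ?inE.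
have /choice[f fP] x : exists y, [/\ x = p -> y = u 0,
    forall n, x = u n -> y = u n.+1 &
    x <> p -> (forall n, x <> u n) -> y = x].
  have [->|xp] := pselect (x = p).
    by exists (u 0); split=> // n pu; case: (uS n).
  have [[n ->]|xu] := pselect (exists n, x = u n).
    exists (u n.+1); split=> [/uS//|m /uI->//|_ /(_ n)//].
  by exists x; split=> // n xn; case: xu; exists n.
have fp : f p = u 0 by case: (fP p) => + _ _; exact.
have fu n : f (u n) = u n.+1 by case: (fP (u n)) => _ + _; exact.
have fx x : x <> p -> (forall n, x <> u n) -> f x = x by case: (fP x).
have cases x : [\/ x = p, exists n, x = u n | x <> p /\ forall n, x <> u n].
  have [->|xp] := pselect (x = p); first exact: Or31.
  have [xu|xu] := pselect (exists n, x = u n); first exact: Or32.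
  by apply: Or33; split=> // n xn; apply: xu; exists n.
exists f.
  move=> x y; case: (cases x) => [->|[n ->]|[xp xu]];
    case: (cases y) => [->|[m ->]|[yp yu]] //;
    rewrite ?fp ?fu ?(fx x) ?(fx y) // => E.
  - by have := uI _ _ E.
  - by case: (yu 0).
  - by have := uI _ _ E.
  - by case: (uI _ _ E) => ->.
  - by case: (yu n.+1).
  - by case: (xu 0).
  - by case: (xu m.+1).
move=> y; split=> [yp|[x <-]].
  case: (cases y) => [//|[[|n] ->]|[_ yu]]; [by exists p|by exists (u n)|].
  by exists y; exact: fx.
case: (cases x) => [->|[n ->]|[xp xu]]; rewrite ?fp ?fu ?fx //; exact: uS.
Qed.

(** A matching that is maximal for inclusion leaves at most one point
    unmatched.  If it leaves [p], transporting it along a bijection from the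
    whole set onto the complement of [p] makes it perfect. *)
Lemma infinite_fpf_involution (T : Type) : infinite_set [set: T] ->
  exists2 j : T -> T, involutive j & forall x, j x <> x.
Proof.
move=> infT.
pose matching (R : set (T * T)) := [/\ forall x y, R (x, y) -> R (y, x),
  forall x y z, R (x, y) -> R (x, z) -> y = z & forall x, ~ R (x, x)].
have [R [[Rsym Rfun Rirr] Rmax]] :
    exists R, matching R /\ forall R', R `<` R' -> ~ matching R'.
  apply: Zorn_bigcup => F FP totF.
  split=> [x y [X FX Xxy]|x y z [X FX Xxy] [Y FY Yxz]|x [X FX]].
  - by exists X => //; have [+ _ _] := FP _ FX; exact.
  - have [XY|YX] := totF _ _ FX FY.
    + by have [_ + _] := FP _ FY; apply; [exact: XY Xxy|exact: Yxz].
    + by have [_ + _] := FP _ FX; apply; [exact: Xxy|exact: YX Yxz].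
  - by have [_ _ +] := FP _ FX; exact.
pose cov x := exists y, R (x, y).
have uncov_uniq x y : ~ cov x -> ~ cov y -> x = y.
  move=> ncx ncy; have [//|xy] := pselect (x = y).
  pose R' := R `|` [set (x, y); (y, x)].
  have ncR z w : R (z, w) -> [/\ z <> x, z <> y, w <> x & w <> y].
    by move=> Rzw; split=> E; subst; [case: ncx|case: ncy|case: ncx|case: ncy];
      by [exists w|exists z; exact: Rsym].
  case: (Rmax R').
    split; first exact: subsetUl.
    move=> /(_ (x, y) (or_intror (or_introl erefl))) Rxy.
    by apply: ncx; exists y.
  split=> [z w [/Rsym|[[-> ->]|[-> ->]]]|z w v|z [/Rirr//|[[-> E]|[-> E]]]].
  - by left.
  - by right; right.
  - by right; left.
  - move=> [zw|[[z1 ->]|[z1 ->]]] [zv|[[z2 ->]|[z2 ->]]] //;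
      try by case: (ncR _ _ zw).
    + exact: Rfun zw zv.
    + by case: (ncR _ _ zv).
    + by case: xy; rewrite -z1 -z2.
    + by case: (ncR _ _ zv).
    + by case: xy; rewrite -z1 -z2.
  - by case: xy.
  - by case: xy.
(* A bijection from the whole type onto the set of matched points. *)
have [f fI fcov] : exists2 f : T -> T, injective f & forall y, cov y <-> exists x, f x = y.
  have [[p ncp]|allcov] := pselect (exists p, ~ cov p).
    have [f fI fP] := infinite_bij_setC1 p infT; exists f => // y; rewrite -fP.
    split=> [cy yp|yp]; first by apply: ncp; rewrite -yp.
    by apply: contrapT => ncy; apply: yp; exact: uncov_uniq.
  exists id => // y; split=> [_|_]; first by exists y.
  by apply: contrapT => ncy; apply: allcov; exists y.
have /choice[j jP] x : exists y, R (f x, f y).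
  have [y Rfxy] : cov (f x) by apply/fcov; exists x.
  have [z yz] : exists z, f z = y by apply/fcov; exists (f x); exact: Rsym.
  by exists z; rewrite yz.
exists j => x.
  by apply: fI; apply: (Rfun (f (j x))) => //; exact: Rsym.
by move=> jx; apply: (Rirr (f x)); rewrite -{2}jx.
Qed.

Lemma infinite_set_fpf_involution (T : Type) (A : set T) : infinite_set A ->
  exists j : T -> T, [/\ involutive j, forall x, A x -> A (j x),
    forall x, A x -> j x <> x & forall x, ~ A x -> j x = x].
Proof.
move=> infA.
have infsA : infinite_set [set: A].
  by apply: contra_not infA; rewrite (eq_finite_set (card_setT A)).
have [j jK jN] := infinite_fpf_involution infsA.
pose k x := if pselect (A x) is left Ax then val (j (SigSub (mem_set Ax))) else x.
have kval (a : A) : k (val a) = val (j a).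
  rewrite /k; case: pselect => [Ax|[]]; last exact: set_valP.
  by congr (val (j _)); exact: val_inj.
have kN x : ~ A x -> k x = x by rewrite /k; case: pselect.
have AE x : A x -> exists a : A, x = val a by move=> Ax; exists (SigSub (mem_set Ax)).
exists k; split=> [x|x|x|//].
- have [/AE[a ->]|Ax] := pselect (A x); first by rewrite !kval jK.
  by rewrite !kN.
- by move=> /AE[a ->]; rewrite kval; exact: set_valP.
- by move=> /AE[a ->]; rewrite kval => /val_inj; exact: jN.
Qed.

(** * Involutions in the injection monoid *)

(** [K] picks one point in each 2-cycle of [i]. *)
Lemma involution_transversal (T : Type) (i : T -> T) : involutive i ->
  exists K : set T, forall x, i x <> x -> K (i x) <-> ~ K x.
Proof.
move=> iK; have [[x0 _]|T0] := pselect (exists x : T, True); last first.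
  by exists set0 => x; case: T0; exists x.
have [c cP] := set_selector x0.
exists [set x | c [set x; i x] = x] => x ix /=.
rewrite iK (setUC [set i x]); split=> [-> //|cx].
by have [/cx|] := cP [set x; i x] x (or_introl erefl).
Qed.

(** With [r] a base point on the orbit of [x], the involution is
    [g^k r |-> g^-k r], for an integer [k].  This is well defined even on finite
    orbits, and conjugates [g] to its inverse.  To stay with iterates by natural
    numbers, [k] is represented as a difference [n - m]. *)
Lemma bijection_two_involutions (T : Type) (g g' : T -> T) :
    cancel g g' -> cancel g' g ->
  exists2 a, involutive a & involutive (g \o a).
Proof.
move=> gK g'K; have [[x0 _]|T0] := pselect (exists x : T, True); last first.
  by exists id => x //; case: T0; exists x.
have [c cP] := set_selector x0.
pose orb x := [set y | exists m n, iter m g x = iter n g y].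
have gI n : injective (iter n g) by elim: n => [|n IHn] x y //= /(can_inj gK)/IHn.
have orb_eq x y : orb x y -> orb x = orb y.
  move=> [m [n xy]]; apply/seteqP; split=> z [k [l E]].
    exists (k + n), (m + l).
    by rewrite iterD -xy -iterD addnC iterD E -iterD.
  exists (k + m), (n + l).
  by rewrite iterD xy -iterD addnC iterD E -iterD.
have orb_refl x : orb x x by exists 0, 0.
pose r x := c (orb x).
have rorb x : orb x (r x) by exact: cP (orb_refl x).
have rE x y : orb x y -> r x = r y by move=> /orb_eq; rewrite /r => ->.
pose refl x y := exists m n,
  iter m g x = iter n g (r x) /\ iter m g (r x) = iter n g y.
have reflE x y z : refl x y -> refl x z -> y = z.
  move=> [m [n [mx ny]]] [k [l [kx lz]]]; apply: (gI (n + l)).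
  rewrite addnC iterD -ny addnC iterD -lz -!iterD.
  rewrite addnC (addnC n) [LHS]iterD -kx [RHS]iterD -mx.
  by rewrite -!iterD addnC.
have refl_r x y : refl x y -> r y = r x.
  by move=> [m [n [_ E]]]; rewrite (rE _ _ (rorb x)) -(rE (r x) y) //; exists m, n.
have refl_sym x y : refl x y -> refl y x.
  move=> xy; have ry := refl_r _ _ xy; case: xy => m [n [mx ny]].
  by exists n, m; rewrite ry.
have /choice[a aP] x : exists y, refl x y.
  have [m [n E]] := rorb x; exists (iter n g' (iter m g (r x))), m, n; split=> //.
  elim: n {E} (iter m g (r x)) => //= n IHn y.
  by rewrite -iterS iterSr g'K.
exists a => x; first exact: reflE (aP (a x)) (refl_sym _ _ (aP x)).
rewrite /=; suff -> : a (g (a x)) = g' x by rewrite g'K.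
apply: reflE (aP _) _.
have rg y : r (g y) = r y by apply: rE; exists 0, 1%N.
have := refl_r _ _ (aP x); case: (aP x) => m [n [mx nax]] ra.
exists n, m.+1; rewrite rg ra; split; first by rewrite -iterSr iterS -nax.
by rewrite iterSr g'K.
Qed.

Section Involutions.
Variable T : Type.
Implicit Types (i : T -> T).

Definition invmap i (iK : involutive i) : injmap T := InjMap (inv_inj iK).

Lemma invmap_sq i (iK : involutive i) : invmap iK * invmap iK = 1.
Proof. by apply: injmap_eq; apply/funext => x; exact: iK. Qed.

(** [H] is half of the support of [i]; a fixed-point-free involution [j] of [H]
    is extended to an involution [t] commuting with [i].  Taking a transversal
    [L] of [j] and its image under [i] gives an [i]-stable set [M] such that the
    support of [i] is the disjoint union of [M] and its image under [t].  If [h]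
    is [i] on [M] and the identity elsewhere, then [t * h * t] is [i] on that
    image and the identity elsewhere, so [i = h * (t * h * t)], which is
    equivalent to [h * h * t * t = 1]. *)
Lemma sim_involution_infinite i (iK : involutive i) :
  infinite_set [set x | i x <> x] -> sim (invmap iK) 1.
Proof.
move=> inf_supp; have [K KP] := involution_transversal iK.
pose H := [set x | i x <> x /\ K x].
have iN x : i x <> x -> i (i x) <> i x by move=> ix; rewrite iK; apply: nesym.
have Hdisj x : H x -> ~ H (i x) by move=> [ix Kx] [_ /(KP _ ix)].
have Hcov x : i x <> x -> H x \/ H (i x).
  move=> ix; have [Kx|nKx] := pselect (K x); first by left.
  by right; split; [exact: iN|apply/KP].
have infH : infinite_set H.
  move=> finH; apply: inf_supp; apply: (@sub_finite_set _ _ (H `|` i @` H)).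
    by move=> x /Hcov[|Hix]; [left|right; exists (i x)].
  by rewrite finite_setU; split=> //; exact: finite_image.
have [j [jK jH jN jid]] := infinite_set_fpf_involution infH.
have [L LP] := involution_transversal jK.
pose t x :=
  if `[< H x >] then j x else if `[< H (i x) >] then i (j (i x)) else x.
have tH x : H x -> t x = j x by rewrite /t => /asboolT->.
have tiH x : H x -> t (i x) = i (j x).
  by move=> Hx; rewrite /t iK (asboolF (Hdisj _ Hx)) (asboolT Hx).
have tid x : i x = x -> t x = x.
  by move=> ix; rewrite /t ix; case: asboolP => // -[].
have cases x : [\/ i x = x, H x | exists2 y, H y & x = i y].
  have [ix|/Hcov[Hx|Hx]] := pselect (i x = x); [exact: Or31|exact: Or32|].
  by apply: Or33; exists (i x).
have tK : involutive t.
  move=> x; case: (cases x) => [ix|Hx|[y Hy ->]]; first by rewrite !tid.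
    by rewrite !tH ?jK //; exact: jH.
  by rewrite !tiH ?jK //; exact: jH.
have ti x : t (i x) = i (t x).
  case: (cases x) => [ix|Hx|[y Hy ->]]; first by rewrite !(tid x, ix).
    by rewrite tiH ?tH.
  by rewrite iK tiH ?tH ?iK.
pose M := [set x | (H x /\ L x) \/ (H (i x) /\ L (i x))].
have Mi x : M (i x) <-> M x by rewrite /M /= iK; split=> -[]; by [left|right].
have MH x : H x -> M x <-> L x.
  by move=> Hx; split=> [[[]//|[/(Hdisj _ Hx)]]//|Lx]; left.
have Mt x : i x <> x -> M (t x) <-> ~ M x.
  have MtH y : H y -> M (t y) <-> ~ M y.
    move=> Hy; have := LP _ (jN _ Hy).
    by rewrite tH // (MH _ Hy) (MH _ (jH _ Hy)).
  case/Hcov=> [/MtH //|/MtH].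
  by rewrite ti !Mi.
pose h x := if `[< M x >] then i x else x.
have hM x : M x -> h x = i x by rewrite /h => /asboolT->.
have hN x : ~ M x -> h x = x by rewrite /h => /asboolF->.
have hK : involutive h.
  move=> x; have [Mx|nMx] := pselect (M x); last by rewrite !hN.
  by rewrite !hM ?iK //; apply/Mi.
have -> : invmap iK = invmap hK * invmap tK * invmap hK * invmap tK.
  apply: injmap_eq; apply/funext => x /=; rewrite /comp.
  have [ix|ix] := pselect (i x = x).
    have hid : h x = x by rewrite /h ix; case: ifP.
    by rewrite !(hid, tid).
  have [Mx|nMx] := pselect (M x).
    rewrite (hN (t x)); last by move/(Mt _ ix).
    by rewrite tK hM.
  rewrite (hM (t x)); last exact/Mt.
  by rewrite -ti tK hN // => /Mi.
apply: (sim_trans (t := invmap hK * invmap hK * (invmap tK * invmap tK)));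
  last first.
  by rewrite !invmap_sq mulg1; exact: sim_refl.
have := sim_mul (invmap hK) (invmap tK) (simC (invmap tK) (invmap hK)).
by rewrite !mulgA.
Qed.

(** If [i] moves finitely many points, it fixes infinitely many: an involution
    [j] supported there commutes with [i], and [i = (i \o j) \o j] where both
    factors have infinite support. *)
Lemma sim_involution i (iK : involutive i) :
  infinite_set [set: T] -> sim (invmap iK) 1.
Proof.
move=> infT.
have [finS|infS] := pselect (finite_set [set x | i x <> x]); last first.
  exact: sim_involution_infinite.
pose F := [set x | i x = x].
have infF : infinite_set F.
  move=> finF; apply: infT; apply: (@sub_finite_set _ _ ([set x | i x <> x] `|` F)).
    by move=> x _; have [ix|ix] := pselect (i x = x); [right|left].
  by rewrite finite_setU.
have [j [jK jF jN jid]] := infinite_set_fpf_involution infF.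
pose k x := i (j x).
have ij x : i (j x) = j (i x).
  have [ix|ix] := pselect (i x = x); first by rewrite ix; exact: (jF _ ix).
  by rewrite !jid // => ?; apply: ix => //; apply: (inv_inj iK).
have kK : involutive k by move=> x; rewrite /k -ij jK iK.
have -> : invmap iK = invmap kK * invmap jK.
  by apply: injmap_eq; apply/funext => x; rewrite /= /k /comp jK.
rewrite -[X in sim _ X]mulg1; apply: simM; apply: sim_involution_infinite;
  apply: sub_infinite_set infF => x Fx /=; last exact: jN.
by rewrite /k jF //; exact: jN.
Qed.

Lemma sim_bijection (g : injmap T) : infinite_set [set: T] ->
  bijective g -> sim g 1.
Proof.
move=> infT [g' gK g'K]; have [a aK gaK] := bijection_two_involutions gK g'K.
have -> : g = invmap gaK * invmap aK.
  by apply: injmap_eq; apply/funext => x; rewrite /= /comp aK.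
by rewrite -[X in sim _ X]mulg1; apply: simM; exact: sim_involution.
Qed.

End Involutions.

(** * The cardinality of the complement of the range *)

(** The point [u0] serves as the value of the bijection outside [A]. *)
Lemma card_eq_set_bij (T U : Type) (A : set T) (B : set U) (u0 : U) :
  A #= B -> exists f, set_bij A B f.
Proof. by elim/Ppointed: U => U in B u0 *; [have := no u0|move/card_set_bijP]. Qed.

(** Disjoint unions represent sums of cardinals. *)
Definition set_sum (T U : Type) (A : set T) (B : set U) : set (T + U) :=
  [set z | match z with inl x => A x | inr y => B y end].

Lemma card_set_sum (T U : Type) (t0 : T) (u0 : U) (A A' : set T) (B B' : set U) :
  A #= A' -> B #= B' -> set_sum A B #= set_sum A' B'.
Proof.
move=> /(card_eq_set_bij t0)[f [fS fI fV]] /(card_eq_set_bij u0)[g [gS gI gV]].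
pose h z := match z with inl x => inl (f x) | inr y => inr (g y) end.
have -> : set_sum A' B' = h @` set_sum A B.
  apply/seteqP; split=> [[x /fV[y Ay <-]|x /gV[y By <-]]|_ [[x|x] /= ABx <-]].
  - by exists (inl y).
  - by exists (inr y).
  - exact: fS.
  - exact: gS.
apply/card_esym/inj_card_eq => -[x|x] [y|y]; rewrite ?inE //= => Ax Ay [].
  by move/fI => ->; rewrite ?inE.
by move/gI => ->; rewrite ?inE.
Qed.

Lemma card_set_sumC (T U : Type) (A : set T) (B : set U) :
  set_sum A B #= set_sum B A.
Proof.
pose h (z : T + U) : U + T := match z with inl x => inr x | inr y => inl y end.
have -> : set_sum B A = h @` set_sum A B.
  apply/seteqP; split=> [[x ABx|x ABx]|_ [[x|x] ABx <-]] //.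
    by exists (inr x).
  by exists (inl x).
by apply/card_esym/inj_card_eq => -[x|x] [y|y] _ _ //= -[->].
Qed.

Section Infinite.
Variable T : Type.
Implicit Types s t : injmap T.

Lemma card_setC_rangeM s t :
  ~` range (s * t) #= set_sum (~` range s) (~` range t).
Proof.
pose h (z : T + T) := match z with inl x => x | inr y => s y end.
have -> : ~` range (s * t) = h @` set_sum (~` range s) (~` range t).
  apply/seteqP; split=> [y Ny|_ [[y|x] /= N <-] [z _ E]].
  - have [[x _ sxy]|Nsy] := pselect (range s y); last by exists (inl y).
    exists (inr x) => // -[z _ tz]; apply: Ny; exists z => //.
    by rewrite -sxy -tz.
  - by apply: N; exists (t z).
  - by apply: N; exists z => //; apply: (@injmapP _ s).
apply/inj_card_eq => -[x|x] [y|y]; rewrite ?inE //= => Nx Ny E.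
- by rewrite E.
- by case: Nx; exists y.
- by case: Ny; exists x.
- by rewrite (@injmapP _ s _ _ E).
Qed.

Lemma sim_card_setC_range s t : sim s t -> ~` range s #= ~` range t.
Proof.
have [[x0 _]|T0] := pselect (exists x : T, True); last first.
  by suff -> : s = t by []; apply/injmap_eq/funext => x; case: T0; exists x.
apply: (@sim_least _ (fun s t => ~` range s #= ~` range t)).
- by move=> {}s; exact: card_eqxx.
- by move=> {}s {}t /card_esym.
- by move=> u v w; exact: card_eq_trans.
- move=> u u' v v' uu' vv'; apply: card_eq_trans (card_setC_rangeM u v) _.
  apply: card_eq_trans (card_esym (card_setC_rangeM u' v')).
  exact: card_set_sum.
- move=> u v; apply: card_eq_trans (card_setC_rangeM u v) _.
  apply: card_eq_trans (card_esym (card_setC_rangeM v u)).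
  exact: card_set_sumC.
Qed.

(** The bijection sends [s x] to [t x], and is any bijection between the
    complements elsewhere. *)
Lemma card_setC_range_bijection s t : ~` range s #= ~` range t ->
  exists2 g : injmap T, bijective g & t = g * s.
Proof.
have [[x0 _]|T0] := pselect (exists x : T, True); last first.
  exists 1; first by exists id.
  by apply/injmap_eq/funext => x; case: T0; exists x.
move=> /(card_eq_set_bij x0)[f [fS fI fV]].
have /choice[g gP] y : exists z,
    (forall x, y = s x -> z = t x) /\ (~ range s y -> z = f y).
  have [[x _ <-]|Nsy] := pselect (range s y).
    by exists (t x); split=> [z /(@injmapP _ s)->|[]] //; exists x.
  by exists (f y); split=> // x yx; case: Nsy; exists x.
have gs x : g (s x) = t x by case: (gP (s x)) => + _; exact.
have gN y : ~ range s y -> g y = f y by case: (gP y).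
have cases y : (exists x, y = s x) \/ ~ range s y.
  have [[x _ <-]|] := pselect (range s y); last by right.
  by left; exists x.
have gI : injective g.
  move=> y z; case: (cases y) => [[x ->]|Ny];
    case: (cases z) => [[w ->]|Nz];
    rewrite ?gs ?gN // => E.
  - by rewrite (@injmapP _ t _ _ E).
  - by case: (fS z Nz); exists x.
  - by case: (fS y Ny); exists w.
  - by apply: fI; rewrite ?inE.
exists (InjMap gI) => /=; last by apply/injmap_eq/funext => x; rewrite /= gs.
rewrite -setTT_bijective; split=> // [x y _ _|z _]; first exact: gI.
have [[x _ <-]|/fV[y Ny <-]] := pselect (range t z).
  by exists (s x); rewrite ?gs.
by exists y; rewrite ?gN.
Qed.

Lemma sim_infiniteP s t : infinite_set [set: T] ->
  sim s t <-> ~` range s #= ~` range t.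
Proof.
move=> infT; split; first exact: sim_card_setC_range.
case/card_setC_range_bijection=> g /(sim_bijection infT) g1 ->.
by apply/sim_sym; have := simM g1 (sim_refl s); rewrite mul1g.
Qed.

End Infinite.

(** * Finite sets and the sign *)

Section Finite.
Variables (T : Type) (finT : finite_set [set: T]).
Local Notation FT := (fin_carrier finT).
Implicit Types (s t : injmap T) (u v : {perm FT}).

Definition perm_injmap u : injmap T := @InjMap T u (@perm_inj FT u).

Lemma injmap_permK s : perm_injmap (injmap_perm finT s) = s.
Proof. by apply/injmap_eq/funext => x; rewrite /= permE. Qed.

(** The order is reversed because permutations compose from left to right and
    injective maps from right to left. *)
Lemma perm_injmapM u v : perm_injmap (u * v) = perm_injmap v * perm_injmap u.
Proof. by apply/injmap_eq/funext => x; rewrite /= permM. Qed.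

Lemma perm_injmap1 : perm_injmap 1 = 1.
Proof. by apply/injmap_eq/funext => x; rewrite /= perm1. Qed.

Lemma injmap_permM s t :
  injmap_perm finT (s * t) = injmap_perm finT t * injmap_perm finT s.
Proof. by apply/permP => x; rewrite permM !permE. Qed.

Lemma sim_odd_perm s t : sim s t ->
  odd_perm (injmap_perm finT s) = odd_perm (injmap_perm finT t).
Proof.
pose sgn s := odd_perm (injmap_perm finT s).
apply: (@sim_least _ (fun s t => sgn s = sgn t)); rewrite /sgn.
- by [].
- by move=> u v ->.
- by move=> u v w -> ->.
- by move=> u u' v v' Eu Ev; rewrite !injmap_permM !odd_permM Eu Ev.
- by move=> u v; rewrite !injmap_permM !odd_permM addbC.
Qed.

Lemma tperm_conj (U : finType) (a b c d : U) : a != b -> c != d ->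
  exists w : {perm U}, tperm a b ^ w = tperm c d.
Proof.
move=> ab cd; pose b' := tperm a c b; exists (tperm a c * tperm b' d).
rewrite tpermJ !permM tpermL -/b' tpermL tpermD 1?eq_sym //.
by rewrite -(tpermL a c) (inj_eq perm_inj).
Qed.

(** The second transposition is a conjugate [w^-1 * u * w] of the first one [u];
    modulo [sim] the factors [w^-1] and [w] cancel and [u * u = 1] remains. *)
Lemma sim_tpermM (x y : FT * FT) : dpair x -> dpair y ->
  sim (perm_injmap (tperm x.1 x.2 * tperm y.1 y.2)) 1.
Proof.
move=> xd yd; have [w <-] := tperm_conj xd yd.
set u := tperm _ _; rewrite conjgE !perm_injmapM.
have := simM (simC (perm_injmap w * perm_injmap u) (perm_injmap w^-1))
  (sim_refl (perm_injmap u)).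
by rewrite -!perm_injmapM mulgK tperm2 perm_injmap1.
Qed.

(** The transpositions of a decomposition are removed two at a time. *)
Lemma sim_even_perm u : ~~ odd_perm u -> sim (perm_injmap u) 1.
Proof.
have [ts -> dts] := prod_tpermP u; rewrite odd_perm_prod //.
have [n] := ubnP (size ts); elim: n ts dts => // n IHn [|x [|y ts]] //=.
  by move=> _ _ _; rewrite big_nil perm_injmap1; exact: sim_refl.
move=> /and3P[xd yd dts] /ltnSE/ltnW szn; rewrite negbK => ets.
rewrite !big_cons mulgA perm_injmapM -[X in sim _ X]mulg1.
by apply: simM; [exact: IHn|exact: sim_tpermM].
Qed.

Lemma sim_finiteP s t : sim s t <-> ~~ odd_perm (injmap_div finT s t).
Proof.
have E : odd_perm (injmap_div finT s t) =
    odd_perm (injmap_perm finT s) (+) odd_perm (injmap_perm finT t).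
  by rewrite /injmap_div odd_permM odd_permV addbC.
split=> [/sim_odd_perm st|/sim_even_perm ev]; first by rewrite E st addbb.
rewrite -(injmap_permK s) -(injmap_permK t).
rewrite -[injmap_perm finT s](mulKVg (injmap_perm finT t)) perm_injmapM.
by have := simM ev (sim_refl (perm_injmap (injmap_perm finT t))); rewrite mul1g.
Qed.

Lemma injective_bijective_finite :
  [set f : T -> T | injective f] = [set f : T -> T | bijective f].
Proof.
apply/seteqP; split=> f /=; last exact: bij_inj.
exact: (@injF_bij FT).
Qed.

End Finite.

Unset Implicit Arguments.

Theorem theorem37 (Omega : Type) (s t : injmap Omega) :
  (infinite_set [set: Omega] ->
     (sim s t <-> ~` range s #= ~` range t)) /\
  (forall finOmega : finite_set [set: Omega],
     [set f : Omega -> Omega | injective f] = [set f : Omega -> Omega | bijective f] /\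
     (sim s t <-> ~~ odd_perm (injmap_div finOmega s t))).
Proof.
split=> [infO|finO]; first exact: sim_infiniteP.
by split; [exact: injective_bijective_finite|exact: sim_finiteP].
Qed.
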